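(* For any positive integers $d$ and $\ell$ there exists a constant $c := c(d,\ell)$ such that, for every integer $n\ge d$, every $n$-vertex $d$-degenerate graph $G$ satisfies \[ \chi_{\ell\text{-vr}}(G)\le c\, n^{1-\frac{1}{\lfloor \ell/2\rfloor+1/2}}\log n = \begin{cases} c\,n^{1-\frac{2}{\ell}}\log n & \text{if } \ell \text{ is odd},\\ c\,n^{1-\frac{2}{\ell+1}}\log n & \text{if } \ell \text{ is even}. \end{cases} \]
   Context: Graphs are finite, simple and undirected. A graph $G$ is $d$-degenerate if every non-empty (induced) subgraph of $G$ has a vertex of degree at most $d$ in that subgraph. For a positive integer $\ell$, an $\ell$-vertex-ranking of a graph $G$ is a colouring $\varphi$ of the vertices of $G$ with integer colours such that in every connected subgraph $H$ of $G$ with diameter at most $\ell$, there is a vertex of $H$ whose colour is larger than that of every other vertex of $H$. The $\ell$-vertex-ranking number $\chi_{\ell\text{-vr}}(G)$ is the minimum integer $k$ such that $G$ has an $\ell$-vertex-ranking $\varphi:V(G)\to\{1,\ldots,k\}$.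
   Formalization: The formal theorem assumes ℓ ≥ 2 and n ≥ 2: for ℓ = 1 the bound c·log n/n tends to 0, and for n = 1 (possible when d = 1) it equals 0, while every non-empty graph needs at least one colour, so the claim fails in both cases. *)

(* Defs.v *)
(* A graph is given by a finType of vertices and a symmetric irreflexive
   adjacency relation. *)
From HB Require Import structures.
From mathcomp Require Import all_boot all_order all_algebra.
From mathcomp Require Import all_classical all_reals all_analysis.

Set Implicit Arguments.
Unset Strict Implicit.
Unset Printing Implicit Defensive.

Import Order.TTheory GRing.Theory Num.Theory.

Definition simple_graph (T : finType) (e : rel T) : Prop :=
  symmetric e /\ irreflexive e.

Definition degenerate (T : finType) (e : rel T) (d : nat) : Prop :=
  forall S : {set T}, S != finset.set0 ->
    exists2 x, x \in S & #|[set y in S | e x y]| <= d.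

(* A subgraph is a pair (S, f) of a vertex set and an adjacency relation; it
   need not be induced. *)
Definition subgraph (T : finType) (e : rel T) (S : {set T}) (f : rel T) : Prop :=
  symmetric f /\ forall x y, f x y -> [/\ e x y, x \in S & y \in S].

Definition connected_graph (T : finType) (S : {set T}) (f : rel T) : Prop :=
  S != finset.set0 /\ {in S &, forall x y, connect f x y}.

Definition walk (T : finType) (f : rel T) (k : nat) (x y : T) : bool :=
  [exists p : k.-tuple T, path f x p && (last x p == y)].

(* A shortest walk has fewer than #|T| edges, so for connected x and y this is
   the usual distance; otherwise it is #|T|. *)
Definition gdist (T : finType) (f : rel T) (x y : T) : nat :=
  \big[minn/#|T|]_(k < #|T| | walk f k x y) k.

(* Distances are taken inside (S, f). *)
Definition diameter (T : finType) (S : {set T}) (f : rel T) : nat :=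
  \max_(x in S) \max_(y in S) gdist f x y.

Definition vertex_ranking (T : finType) (e : rel T) (l : nat) (phi : T -> int)
    : Prop :=
  forall (S : {set T}) (f : rel T),
    subgraph e S f -> connected_graph S f -> diameter S f <= l ->
    exists2 x, x \in S & forall y, y \in S -> y != x -> (phi y < phi x)%R.

Definition vr_colourable (T : finType) (e : rel T) (l k : nat) : Prop :=
  exists2 phi : T -> int,
    (forall x, (1 <= phi x <= k%:Z)%R) & vertex_ranking e l phi.

Lemma vr_colourable_exists (T : finType) (e : rel T) (l : nat) :
  exists k, `[< vr_colourable e l k >].
Proof.
exists #|T|; apply/asboolP.
exists (fun x => Posz (enum_rank x).+1) => [x|S f _ [/set0Pn[x0 x0S] _] _].
  by rewrite !lez_nat /= ltn_ord.
case: (@arg_maxnP _ x0 (fun x => x \in S) (fun x => enum_rank x : nat) x0S).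
move=> x xS xmax; exists x => // y yS yx.
rewrite ltz_nat ltnS ltn_neqAle; apply/andP; split; last exact: xmax.
by apply: contra_neq yx => /val_inj/enum_rank_inj.
Qed.

Definition vr_number (T : finType) (e : rel T) (l : nat) : nat :=
  ex_minn (vr_colourable_exists e l).

(* Main.v *)
(* Write m for l/2, k for s^(2m-1) with s^(2m+1) about n, so that n/s^2 <= k; all
   bounds below are up to constants depending on d and l.  A ranking is a
   colouring in which every walk of length at most 2m+1 between distinct
   vertices of equal colour meets a larger colour.

   Repeatedly peeling off the vertices of bounded degree yields log n layers such
   that every vertex has boundedly many neighbours in its own and later layers;
   call a step into an earlier layer a descent.  The n/s^2 vertices with more
   than s^2 descents get private top colours, so that a walk with a descents
   has only s^(2a) possible ends.  Give each layer its own interval of k colours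
   and colour each vertex at random within the interval of its layer.  If a walk
   x, y, ..., z, v with ends in one layer stays weakly below that layer, then one
   of the subwalks y..v and z..x has at most m - 1 descents.  Hence every
   monochromatic such walk is broken by raising y or z above all layers, where a
   vertex w is raised when some u above it and some v reached from it with m - 1
   descents have the same colour.  By a first moment count, only n/s vertices
   ascend to a raised one, so only n/s^2 vertices have more than s of these below
   them; they also get private top colours.

   A walk of length at most 2m+1 has at most m descents in one of its two
   directions.  If it ends at a raised vertex then its last descent lands on a
   vertex ascending to a raised one, so it has s^(2(m-1)) s = k possible ends,
   and the raised vertices are properly coloured with O(k) new colours. *)
Require Import Defs.
From mathcomp Require Import all_boot all_order all_algebra.
From mathcomp Require Import all_classical all_reals all_analysis.
From mathcomp Require Import zify ring lra.

Set Implicit Arguments.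
Unset Strict Implicit.
Unset Printing Implicit Defensive.

Import Order.TTheory GRing.Theory Num.Theory.

(** * Double counting, greedy colouring and a first moment bound *)

Lemma card_pred_sum (T : finType) (P : pred T) : #|P| = \sum_(x : T) (P x : nat).
Proof. by rewrite -sum1_card big_mkcond; apply: eq_bigr => x _; rewrite unfold_in; case: (P x). Qed.

Section Counting.
Variable T : finType.

Lemma leq_exists_sum (P : pred T) : ([exists x, P x] : nat) <= \sum_(x : T) (P x : nat).
Proof.
case: existsP => // -[x Px]; rewrite (bigD1 x) //= Px.
exact: leq_addr.
Qed.

Lemma card_exists_le (P : pred T) (Q : rel T) (c : nat) :
  (forall z, P z -> #|Q z| <= c) ->
  #|[pred y | [exists z, P z && Q z y]]| <= #|P| * c.
Proof.
move=> Qc; rewrite [X in X <= _]card_pred_sum.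
apply: (@leq_trans (\sum_(y : T) \sum_(z : T) (P z && Q z y : nat))).
  by apply: leq_sum => y _; exact: leq_exists_sum.
rewrite exchange_big /= [X in _ <= X * _]card_pred_sum big_distrl /=; apply: leq_sum => z _.
case Pz: (P z) => /=; last by rewrite big1.
by rewrite mul1n -card_pred_sum; exact: Qc.
Qed.

(** Double count the pairs [r x y] with [y] in [A]: each such [y] has at most [D] predecessors, and
    each [x] counted on the left lies in more than [t] pairs. *)
Lemma card_large_degree (r : rel T) (A : pred T) (D t : nat) :
  (forall y, #|[pred x | r x y]| <= D) ->
  t * #|[pred x | t < #|[pred y | r x y && A y]|]| <= D * #|A|.
Proof.
move=> rD; rewrite [X in t * X]card_pred_sum big_distrr /=.
apply: (@leq_trans (\sum_(x : T) \sum_(y : T) (r x y && A y : nat))).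
  apply: leq_sum => x _; rewrite -(card_pred_sum [pred y | r x y && A y]).
  by case: ltnP => [/ltnW|_]; rewrite ?muln1 ?muln0.
rewrite exchange_big /= [X in D * X]card_pred_sum big_distrr /=; apply: leq_sum => y _.
case: (A y); last by rewrite big1 // => x _; rewrite andbF.
rewrite muln1 (leq_trans _ (rD y)) // card_pred_sum.
by apply: leq_sum => x _; rewrite andbT.
Qed.

(** Summed over [S], in-degrees equal out-degrees, so some [x] has in-degree at most [K] in [S]. It
    has at most [2K] in- and out-neighbours there to avoid, and a colouring of the rest of [S]
    extends to it greedily. *)
Lemma outdegree_colouring (K : nat) (out : rel T) :
  (forall x, #|out x| <= K) ->
  exists psi : T -> nat, (forall x, psi x < K.*2.+1) /\
    forall x y, x != y -> out x y -> psi x != psi y.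
Proof.
move=> outK.
suff H n (S : {set T}) : #|S| = n ->
    exists psi : T -> nat, (forall x, psi x < K.*2.+1) /\
      {in S &, forall x y, x != y -> out x y -> psi x != psi y}.
  have [psi [psiK psiP]] := H _ [set: T]%SET erefl.
  by exists psi; split=> // x y; apply: psiP; rewrite finset.in_setT.
elim: n S => [|n IHn] S Sn.
  exists (fun=> 0); split=> // x y xS.
  by move: Sn => /eqP; rewrite finset.cards_eq0 => /eqP S0; rewrite S0 finset.in_set0 in xS.
have [x xS inK] : exists2 x, x \in S & #|[pred y | (y \in S) && out y x]| <= K.
  apply/exists_inP; apply: contraT => /exists_inPn H.
  have : \sum_(x in S) K.+1 <= \sum_(x in S) K.
    apply: (@leq_trans (\sum_(x in S) #|[pred y | (y \in S) && out y x]|)).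
      by apply: leq_sum => x xS; rewrite ltnNge; exact: H.
    under eq_bigr do rewrite card_pred_sum.
    rewrite exchange_big /= [X in _ <= X]big_mkcond /=; apply: leq_sum => y _.
    case: (y \in S); last by rewrite big1.
    apply: leq_trans (outK y); rewrite card_pred_sum [X in X <= _]big_mkcond.
    by apply: leq_sum => x _; case: (x \in S).
  by rewrite !sum_nat_const Sn leq_pmul2l // ltnn.
have [|psi [psiK psiP]] := IHn (S :\ x)%SET.
  by have := finset.cardsD1 x S; rewrite xS Sn => -[].
pose F := [pred c : 'I_K.*2.+1 | [exists y, ((y \in S) && out y x || out x y) && (psi y == c)]].
have [c cF] : exists c, c \notin F.
  apply/existsP; apply: contraT; rewrite negb_exists => /forallP H.
  have : K.*2.+1 <= K.*2.
    rewrite -{1}(card_ord K.*2.+1).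
    have nb : #|[pred y | (y \in S) && out y x || out x y]| <= K.*2.
      rewrite -addnn; apply: leq_trans (leq_add inK (outK x)).
      rewrite !card_pred_sum -big_split; apply: leq_sum => y _ /=.
      by do 2 case: (_ && _) => //=; case: (out x y).
    apply: leq_trans nb.
    apply: (@leq_trans #|[seq (inord (psi y) : 'I_K.*2.+1) | y in [pred y | (y \in S) && out y x || out x y]]|).
      apply: subset_leq_card; apply/fintype.subsetP => c _.
      have := H c; rewrite negbK => /existsP[y /andP[yP /eqP yc]].
      by apply/fintype.imageP; exists y => //; rewrite yc inord_val.
    exact: leq_image_card.
  by rewrite ltnn.
exists (fun y => if y == x then val c else psi y); split.
  by move=> y; case: ifP => _ //; exact: ltn_ord.
have cP y : (y \in S) && out y x || out x y -> psi y != c.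
  move=> yP; apply: contra cF => yc; apply/existsP; exists y.
  by rewrite yP.
move=> y z yS zS yz yzo; case: (eqVneq y x) => [yx|nyx].
  have -> : (z == x) = false by rewrite -yx eq_sym (negPf yz).
  rewrite eq_sym; apply: cP.
  by rewrite -yx yzo orbT.
case: (eqVneq z x) => [zx|nzx].
  by apply: cP; rewrite -zx yS yzo.
by apply: psiP => //; rewrite finset.in_setD1 ?nyx ?nzx.
Qed.

(** Overwriting the value at [u] by any of the [k] colours is injective on the maps with
    [phi u = phi v], because the old value can be read off at [v]. *)
Lemma card_agree (k : nat) (u v : T) : u != v ->
  k * #|[pred phi : {ffun T -> 'I_k} | phi u == phi v]| <= #|{ffun T -> 'I_k}|.
Proof.
move=> uv.
pose A := [set phi : {ffun T -> 'I_k} | phi u == phi v]%SET.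
have -> : #|[pred phi : {ffun T -> 'I_k} | phi u == phi v]| = #|A|.
  by apply: eq_card => phi; rewrite finset.in_set unfold_in.
pose g (z : 'I_k * {ffun T -> 'I_k}) : {ffun T -> 'I_k} :=
  [ffun t => if t == u then z.1 else z.2 t].
have -> : k * #|A| = #|finset.setX [set: 'I_k]%SET A|.
  by rewrite finset.cardsX finset.cardsT card_ord.
rewrite -(card_in_imset (f := g)); first exact: max_card.
move=> [c phi] [c' phi'] /finset.setXP[_] /=; rewrite finset.inE => /eqP phiA.
move=> /finset.setXP[_] /=; rewrite finset.inE => /eqP phiA' gE.
have E t : g (c, phi) t = g (c', phi') t by rewrite gE.
have E' t : t != u -> phi t = phi' t.
  by move=> tu; have := E t; rewrite !ffunE /= (negPf tu).
congr pair; first by have := E u; rewrite !ffunE eqxx.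
apply/ffunP => t; case: (eqVneq t u) => [->|]; last exact: E'.
by rewrite phiA phiA' E' // eq_sym.
Qed.

(* First moment: a uniformly random colouring makes each pair monochromatic
   with probability 1/k. *)
Lemma sparse_colouring (k : nat) (wt : T -> T -> nat) : 0 < k ->
  exists phi : T -> 'I_k,
    k * (\sum_(u : T) \sum_(v : T) wt u v * ((u != v) && (phi u == phi v)))
      <= \sum_(u : T) \sum_(v : T) wt u v.
Proof.
move=> k0; set W := \sum_(u : T) \sum_(v : T) wt u v.
pose F (phi : {ffun T -> 'I_k}) :=
  k * (\sum_(u : T) \sum_(v : T) wt u v * ((u != v) && (phi u == phi v))).
have N0 : 0 < #|{ffun T -> 'I_k}|.
  by rewrite card_ffun card_ord expn_gt0 k0.
have [phi phiW] : exists phi, F phi <= W.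
  apply/existsP; apply: contraT; rewrite negb_exists => /forallP H.
  have : \sum_(phi : {ffun T -> 'I_k}) W.+1 <= \sum_(phi : {ffun T -> 'I_k}) W.
    apply: (@leq_trans (\sum_phi F phi)).
      by apply: leq_sum => phi _; rewrite ltnNge H.
    rewrite /F -big_distrr exchange_big /= sum_nat_const big_distrr /= [X in _ <= X]big_distrr /=.
    apply: leq_sum => u _; rewrite exchange_big /= !big_distrr /=; apply: leq_sum => v _.
    rewrite -big_distrr /= mulnCA mulnC leq_mul2r; apply/orP; right.
    case: (eqVneq u v) => [_|uv]; first by rewrite big1 ?muln0.
    apply: leq_trans (card_agree k uv); rewrite leq_mul2l; apply/orP; right.
    by rewrite card_pred_sum.
  by rewrite !sum_nat_const leq_pmul2l // ltnn.
by exists phi.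
Qed.

End Counting.

(** * Walks with few descents *)

Section Reach.
Variables (T : finType) (up : rel T) (dn : nat -> rel T).

(* Walks of at most r steps, at most a of which are dn-steps; dn i is the relation
   allowed for a dn-step leaving a budget of i further ones. *)
Fixpoint reach (r a : nat) (x y : T) : bool :=
  (x == y) ||
  if r is r'.+1 then
    [exists z, up x z && reach r' a z y] ||
    (if a is a'.+1 then [exists z, dn a' x z && reach r' a' z y] else false)
  else false.

End Reach.

Section Walks.
Variable T : finType.

Definition nsteps (r : rel T) (x : T) (p : seq T) : nat :=
  count id (pairmap r x p).

Lemma nsteps_cons (r : rel T) x y p :
  nsteps r x (y :: p) = r x y + nsteps r y p.
Proof. by []. Qed.

Lemma nsteps_rcons (r : rel T) x p y :
  nsteps r x (rcons p y) = nsteps r x p + r (last x p) y.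
Proof. by rewrite /nsteps -cats1 pairmap_cat count_cat /= addn0. Qed.

Lemma nsteps_rev (r : rel T) x p :
  nsteps r (last x p) (rev (belast x p)) = nsteps (fun y z => r z y) x p.
Proof.
elim: p x => [|y p IHp] x //=.
rewrite rev_cons nsteps_rcons IHp nsteps_cons addnC; congr (_ + _).
by case: p {IHp} => //= z p; rewrite rev_cons last_rcons.
Qed.

Lemma nsteps_disjoint (r r' : rel T) x p :
  (forall y z, ~~ (r y z && r' y z)) -> nsteps r x p + nsteps r' x p <= size p.
Proof.
move=> rr'; elim: p x => //= y p IHp x; rewrite !nsteps_cons.
have := IHp y; have := rr' x y; case: (r x y); case: (r' x y) => //=; lia.
Qed.

End Walks.

(** * Rankings in terms of walks *)

Lemma gdist_walk (T : finType) (f : rel T) (l : nat) (x y : T) :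
  connect f x y -> gdist f x y <= l ->
  exists p, [/\ path f x p, last x p = y & size p <= l].
Proof.
move=> /connectP[p0 p0P ->]; case/shortenP: p0P => p pP up _.
(* A simple path has fewer than [#|T|] edges, so the minimum in [gdist] is attained by a walk and
   not by its default value. *)
have pT : size p < #|T|.
  by have := max_card (mem (x :: p)); rewrite (card_uniqP up).
set y' := last x p => gl.
suff [k kl /existsP[t /andP[tp /eqP tl]]] : exists2 k, k <= l & walk f k x y'.
  by exists t; rewrite size_tuple.
have [k] : exists2 k : 'I_#|T|, walk f k x y' & gdist f x y' = k.
  have : gdist f x y' <= size p.
    have wp : walk f (Ordinal pT) x y'.
      by apply/existsP; exists (in_tuple p); rewrite pP /= eqxx.
    rewrite /gdist -[size p]/(val (Ordinal pT)).
    have := mem_index_enum (Ordinal pT); elim: (index_enum _) => //= i s IHs.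
    rewrite inE big_cons => /predU1P[<-|/IHs H]; first by rewrite wp geq_minl.
    by case: ifP => // _; rewrite geq_min H orbT.
  move/leq_ltn_trans => /(_ _ pT).
  rewrite /gdist; elim/big_rec: _ => [|i g wi IH]; first by rewrite ltnn.
  rewrite gtn_min => H; case: (leqP i g) => ig.
    by exists i.
  by apply: IH; move: H; rewrite (ltn_trans ig (ltn_ord i)) ; case/orP => // /ltn_trans ->.
by move=> wk E; exists k => //; rewrite -E.
Qed.

(** In a subgraph take [x] of largest colour. Another vertex of that colour would be joined to [x]
    by a walk of length at most [l] inside the subgraph, and this walk would meet a larger colour.
    The shift by one makes the colours start at 1. *)
Lemma vertex_ranking_walk (T : finType) (e : rel T) (l : nat) (col : T -> nat) :
  (forall x p, path e x p -> size p <= l -> x != last x p ->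
    col (last x p) = col x -> exists2 z, z \in p & col x < col z) ->
  vertex_ranking e l (fun x => Posz (col x).+1).
Proof.
move=> colP S f [fsym fP] [/finset.set0Pn[x0 x0S] conn] diam.
case: (@arg_maxnP _ x0 (fun x => x \in S) col x0S) => x xS xmax.
exists x => // y yS yx; rewrite ltz_nat ltnS ltn_neqAle; apply/andP; split; last exact: xmax.
apply/eqP => cyx.
have [p [pf py pl]] : exists p, [/\ path f x p, last x p = y & size p <= l].
  apply: gdist_walk; first exact: conn.
  apply: leq_trans diam; apply: leq_trans (leq_bigmax_cond _ xS).
  exact: leq_bigmax_cond.
have pS : {subset p <= S}.
  elim: p (x) pf {py pl} => //= a p IHp b /andP[ba ap] z; rewrite inE.
  by case/predU1P => [->|/(IHp _ ap)//]; have [] := fP _ _ ba.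
have pe : path e x p by apply: sub_path pf => a b /fP[].
have [||z zp] := colP _ _ pe pl; rewrite ?py // 1?eq_sym //.
by apply/negP; rewrite -leqNgt; apply: xmax; exact: pS.
Qed.

(** * Layering of degenerate graphs *)

Lemma degenerate_degree_sum (T : finType) (e : rel T) (d : nat) (S : {set T}) :
  symmetric e -> irreflexive e -> degenerate e d ->
  \sum_(x in S) #|[set y in S | e x y]%SET| <= d.*2 * #|S|.
Proof.
move=> esym eirr dg; move En: #|S| => n; elim: n S En => [|n IHn] S Sn.
  by move/eqP: Sn; rewrite finset.cards_eq0 => /eqP ->; rewrite finset.big_set0.
have S0 : S != finset.set0 by rewrite -finset.cards_eq0 Sn.
(* Deleting [x] lowers the sum by at most [2d]: its own degree, and one for each neighbour. *)
have [x xS xd] := dg S S0.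
have Sx : #|(S :\ x)%SET| = n by have := finset.cardsD1 x S; rewrite xS Sn => -[].
rewrite (finset.big_setD1 x) //= .
have H y : #|[set z in S | e y z]%SET| = e y x + #|[set z in (S :\ x)%SET | e y z]%SET|.
  rewrite (finset.cardsD1 x) finset.inE xS /=; congr (_ + _).
  by apply: eq_card => z; rewrite !finset.inE andbA.
under eq_bigr do rewrite H.
rewrite big_split /=.
have -> : \sum_(y in (S :\ x)%SET) (e y x : nat) = #|[set y in S | e x y]%SET|.
  rewrite -sum1_card big_mkcond [RHS]big_mkcond /=; apply: eq_bigr => y _.
  rewrite !finset.inE esym; case: (eqVneq y x) => [->|_] /=; first by rewrite eirr andbF.
  by case: (y \in S); case: (e x y).
have := IHn _ Sx; lia.
Qed.

(* Peeling off the vertices of degree at most 4d removes at least half of the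
   vertices at each round. *)
Lemma degenerate_layering (T : finType) (e : rel T) (d L : nat) (S : {set T}) :
  symmetric e -> irreflexive e -> degenerate e d -> #|S| < 2 ^ L ->
  exists lam : T -> nat, {in S, forall x, lam x < L} /\
    {in S, forall x, #|[set y in S | e x y && (lam x <= lam y)]%SET| <= 4 * d}.
Proof.
move=> esym eirr dg; elim: L S => [|L IHL] S SL.
  exists (fun=> 0); split=> x xS; move: SL; rewrite ltnS leqn0 finset.cards_eq0 => /eqP S0;
  by rewrite S0 finset.in_set0 in xS.
pose S' := [set x in S | 4 * d < #|[set y in S | e x y]%SET|]%SET.
have S'L : #|S'| < 2 ^ L.
  have : (4 * d).+1 * #|S'| <= d.*2 * #|S|.
    apply: leq_trans (degenerate_degree_sum S esym eirr dg).
    rewrite mulnC -sum_nat_const big_mkcond [X in _ <= X]big_mkcond; apply: leq_sum => x _.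
    by rewrite finset.inE; case: (x \in S) => //=; case: ltnP.
  rewrite expnS in SL; move: SL; move: (#|S'|) (#|S|) (2 ^ L) => s' s M sM H.
  have := leq_mul (leqnn d.*2) (ltnW sM).
  by rewrite -(ltn_pmul2l (ltn0Sn (4 * d))); nia.
have [lam [lamL lamP]] := IHL _ S'L.
(* The peeled vertices form layer 0 and the others move up by one, so the neighbours of a vertex of
   [S'] in its own or later layers all lie in [S']. *)
exists (fun x => if x \in S' then (lam x).+1 else 0); split => x xS.
  by case: ifP => // /lamL.
case: ifP => xS'; last first.
  move: xS'; rewrite finset.inE xS /= => /negbT; rewrite -leqNgt; apply: leq_trans.
  by apply: subset_leq_card; apply/fintype.subsetP => y; rewrite !finset.inE andbT.
apply: leq_trans (lamP _ xS'); apply: subset_leq_card; apply/fintype.subsetP => y.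
clearbody S'; rewrite !finset.inE; case: (y \in S'); first by case/and3P=> _ -> /=.
by rewrite ltn0 !andbF.
Qed.

(** * Counting the ends of walks *)

Section ReachBounds.
Variables (T : finType) (up : rel T) (dn : nat -> rel T).

(** Each step contributes a factor [D + 2]: 1 for stopping, [D] for an up-step, and 1 for a dn-step,
    whose choices are collected in the product of the [del i]. *)
Lemma card_reach (D : nat) (del : nat -> nat) (r a : nat) (x : T) :
  (forall x, #|up x| <= D) -> (forall i x, #|dn i x| <= del i) ->
  (forall i, 0 < del i) ->
  #|reach up dn r a x| <= D.+2 ^ r * \prod_(i < a) del i.
Proof.
move=> upD dnD del0.
have P0 b : 0 < \prod_(i < b) del i by rewrite prodn_gt0.
have c1 (z : T) : #|pred1 z| = 1 := card1 z.
elim: r a x => [|r IHr] a x.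
  rewrite expn0 mul1n; apply: leq_trans (P0 a).
  rewrite -(c1 x); apply/subset_leq_card/fintype.subsetP => y.
  by rewrite unfold_in /= orbF => /eqP ->; exact: eqxx.
pose A1 := [pred y | [exists z, up x z && reach up dn r a z y]].
pose A2 := [pred y | if a is a'.+1 then [exists z, dn a' x z && reach up dn r a' z y] else false].
have H1 : #|A1| <= D * (D.+2 ^ r * \prod_(i < a) del i).
  apply: leq_trans (card_exists_le (fun z _ => IHr a z)) _.
  by rewrite leq_mul2r upD orbT.
have H2 : #|A2| <= D.+2 ^ r * \prod_(i < a) del i.
  rewrite /A2; case: a {H1 A1 A2} => [|a].
    rewrite (_ : #|_| = 0) //; apply: eq_card0 => z; by rewrite !inE.
  apply: leq_trans (card_exists_le (fun z _ => IHr a z)) _.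
  apply: leq_trans (leq_mul (dnD a x) (leqnn _)) _.
  by rewrite big_ord_recr /= mulnC mulnA.
have H0 : 1 <= D.+2 ^ r * \prod_(i < a) del i by rewrite muln_gt0 expn_gt0 P0.
apply: (@leq_trans (1 + (#|A1| + #|A2|))).
  rewrite -(c1 x) !card_pred_sum -!big_split; apply: leq_sum => y _ /=.
  rewrite [y == x]eq_sym; case: (x == y) => //=.
  by case: [exists z, _]; case: a {H1 H2 H0 A1 A2} => //= a; case: [exists z, _].
rewrite expnS; move: H0 H1 H2; set X := _ * \prod_(_ < _) _; rewrite -mulnA -/X; nia.
Qed.

End ReachBounds.

(** * Walks between layers *)

Section Descents.
Variables (T : finType) (e : rel T) (lam : T -> nat).

Definition ascend : rel T := [rel x y | e x y && (lam x <= lam y)].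
Definition descend : rel T := [rel x y | e x y && (lam y < lam x)].
Definition lower : rel T := [rel x y | lam y < lam x].

Lemma lowerE x y : lower x y = (lam y < lam x).
Proof. by []. Qed.

Lemma mem_reach (A : pred T) (dn : nat -> rel T) (r a : nat) (x : T) (p : seq T) :
  (forall i y z, i < a -> ~~ A y -> descend y z -> dn i y z) ->
  path e x p -> size p <= r -> nsteps lower x p <= a ->
  {in x :: p, forall z, ~~ A z} ->
  reach ascend dn r a x (last x p).
Proof.
elim: p r a x => [|y p IHp] [|r] a x dnA //=; rewrite ?eqxx //.
move=> /andP[xy yp] pr; rewrite nsteps_cons lowerE => da pA; apply/orP; right.
have pA' : {in y :: p, forall z, ~~ A z}.
  by move=> z zp; apply: pA; rewrite inE zp orbT.
case: (ltnP (lam y) (lam x)) da => yx.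
  case: a dnA => // a dnA; rewrite ltnS => da.
  apply/orP; right; apply/existsP; exists y.
  apply/andP; split; first by apply: (dnA _ _ _ (ltnSn a) (pA _ (mem_head _ _))); apply/andP.
  by apply: IHp => // i ? ? ia; apply: dnA; exact: ltnW.
move=> da; apply/orP; left; apply/existsP; exists y.
by apply/andP; split; [exact/andP | apply: IHp].
Qed.

(* On a walk ending in R, the last descent lands on a vertex from which R is
   reached by ascents only. *)
Lemma mem_reach_last (A R : pred T) (dn0 : nat -> rel T) (q r a : nat) (x : T)
    (p : seq T) :
  let S z := [exists w, reach ascend dn0 q 0 z w && R w] in
  path e x p -> size p <= r -> r <= q -> nsteps lower x p <= a ->
  {in x :: p, forall z, ~~ A z} -> R (last x p) ->
  reach ascend
    (fun i => [rel x y | [&& ~~ A x, descend x y & (i == 0) ==> S y]]) r a x (last x p).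
Proof.
move=> S; elim: p r a x => [|y p IHp] [|r] a x //=; rewrite ?eqxx //.
move=> /andP[xy yp] pr rq; rewrite nsteps_cons lowerE => da pA Rl; apply/orP; right.
have pA' : {in y :: p, forall z, ~~ A z}.
  by move=> z zp; apply: pA; rewrite inE zp orbT.
case: (ltnP (lam y) (lam x)) da => yx.
  case: a => // a; rewrite ltnS => da; apply/orP; right; apply/existsP; exists y.
  apply/andP; split; last by apply: IHp => //; exact: ltnW.
  apply/and3P; split; [exact: pA (mem_head _ _) | exact/andP | ].
  apply/implyP => /eqP a0; apply/existsP; exists (last y p); rewrite Rl andbT.
  (* With no descents left, the condition on [dn0] concerns no index and holds vacuously. *)
  apply: (@mem_reach A) => //; last by rewrite -a0.
  exact: leq_trans (pr : size p <= r) (ltnW rq).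
move=> da; apply/orP; left; apply/existsP; exists y.
apply/andP; split; first exact/andP.
by apply: IHp => //; exact: ltnW.
Qed.

(* In a walk x, y, ..., z, v staying weakly below the layer of its ends, y and z
   ascend to x and v, and one of the two subwalks y..v and z..x has at most m - 1
   descents. *)
Lemma walk_has_raised (A : pred T) (dn : nat -> rel T) (k q m : nat)
    (phi : T -> 'I_k) (x : T) (p : seq T) :
  symmetric e -> 0 < m -> size p <= (m.*2).+1 <= q ->
  (forall i y z, ~~ A y -> descend y z -> dn i y z) ->
  path e x p -> {in x :: p, forall z, ~~ A z} -> x != last x p ->
  {in p, forall z, lam z <= lam x} -> lam (last x p) = lam x ->
  phi (last x p) = phi x ->
  exists2 w, w \in x :: p &
    [exists u, [exists v, [&& ascend w u, reach ascend dn q m.-1 w v, u != v & phi u == phi v]]].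
Proof.
move=> esym m0 /andP[pm mq] dnA; case: p pm => [|y p] pm; first by rewrite /= eqxx.
move=> /= /andP[xy yp] pA xv low lv pv.
have yA : {in y :: p, forall z, ~~ A z}.
  by move=> z zp; apply: pA; rewrite inE zp orbT.
have [small|large] := leqP (nsteps lower y p) m.-1.
  exists y; first by rewrite !inE eqxx orbT.
  apply/existsP; exists x; apply/existsP; exists (last y p).
  apply/and4P; split=> //; last by rewrite pv.
    by apply/andP; split; [rewrite esym | exact: low (mem_head _ _)].
  apply: (@mem_reach A) => //; first by move=> i ? ? _; exact: dnA.
  by apply: leq_trans mq; apply: ltnW; move: pm.
case: (lastP p) => [|p0 v] in pm yp pA xv low lv pv yA large *.
  by rewrite /nsteps /= in large.
rewrite last_rcons in xv lv pv; rewrite rcons_path in yp; case/andP: yp => yp zv.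
set z := last y p0 in zv *.
have zp : z \in y :: rcons p0 v.
  by rewrite -rcons_cons mem_rcons inE mem_last orbT.
have zl : lam z <= lam v by rewrite lv low.
(* The step from [z] to [v] is no descent, so the part from [y] to [z] has at least [m] descents
   among at most [2m - 1] steps; its reverse therefore has at most [m - 1]. *)
move: large; rewrite nsteps_rcons lowerE -/z [lam v < _]ltnNge zl addn0 => large.
have E : z = last x (y :: p0) by [].
exists z; first by rewrite inE zp orbT.
apply/existsP; exists v; apply/existsP; exists x.
apply/and4P; split; [exact/andP | | by rewrite eq_sym | by rewrite pv].
have <- : last z (rev (belast x (y :: p0))) = x by rewrite /= rev_cons last_rcons.
have pin : {subset x :: y :: p0 <= x :: y :: rcons p0 v}.
  by move=> t; rewrite -!rcons_cons mem_rcons !inE => ->; rewrite orbT.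
apply: (@mem_reach A).
- by move=> i ? ? _; exact: dnA.
- by rewrite E rev_path (eq_path (e' := e)) /= ?xy // => ? ?; exact: esym.
- by rewrite size_rev size_belast /=; move: pm mq; rewrite /= size_rcons; lia.
- rewrite E nsteps_rev nsteps_cons lowerE [lam x < _]ltnNge low ?mem_head // add0n.
  have := @nsteps_disjoint T lower (fun y z => lower z y) y p0.
  have lt_asym a b : ~~ (lower a b && lower b a) by rewrite !lowerE; lia.
  move=> /(_ lt_asym); move: pm large; rewrite /= size_rcons; lia.
- move=> t; rewrite inE => /predU1P[->|].
    by apply: pA; rewrite inE zp orbT.
  rewrite mem_rev => /mem_belast; move/pin; exact: pA.
Qed.

End Descents.

(** * Construction of the ranking *)

Lemma sum_pred_le (T : finType) (P : pred T) (F : T -> nat) (c : nat) :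
  (forall z, P z -> F z <= c) -> \sum_(z : T) P z * F z <= #|P| * c.
Proof.
move=> Fc; rewrite card_pred_sum big_distrl /=; apply: leq_sum => z _.
by case Pz: (P z); rewrite ?mul0n // !mul1n Fc.
Qed.

Lemma exchange_big22 (T : finType) (f : T -> T -> T -> T -> nat) :
  \sum_(u : T) \sum_(v : T) \sum_(x : T) \sum_(w : T) f u v x w =
  \sum_(x : T) \sum_(w : T) \sum_(u : T) \sum_(v : T) f u v x w.
Proof.
under eq_bigr do rewrite exchange_big /=.
rewrite exchange_big /=; apply: eq_bigr => x _.
under eq_bigr do rewrite exchange_big /=.
by rewrite exchange_big.
Qed.

Lemma prod_const_ord (a s : nat) : \prod_(i < a) s = s ^ a.
Proof. by rewrite prod_nat_const card_ord. Qed.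

Lemma vr_number_le (T : finType) (e : rel T) (l K : nat) (col : T -> nat) :
  (forall x, col x < K) -> vertex_ranking e l (fun x => Posz (col x).+1) ->
  vr_number e l <= K.
Proof.
move=> colK colP; rewrite /vr_number; case: ex_minnP => k _; apply.
by apply/asboolP; exists (fun x => Posz (col x).+1).
Qed.

Section Ranking.
#[local] Arguments reach : simpl never.
Variables (T : finType) (e : rel T) (lam : T -> nat) (D s m L : nat).
Hypotheses (esym : symmetric e) (lamL : forall x, lam x < L)
  (upD : forall x, #|ascend e lam x| <= D)
  (m0 : 0 < m) (s0 : 0 < s) (Ts : #|T| <= s ^ (m.*2).+1).

Let q := (m.*2).+1.
Let k := s ^ (m.*2).-1.
Let B := D.+2 ^ q.
Let up := ascend e lam.
Let down := descend e lam.
Let high : pred T := [pred x | s ^ 2 < #|[pred y | down x y && predT y]|].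
Let dn0 (i : nat) : rel T := [rel x y | ~~ high x && down x y].

Let kE : k = s * s ^ (m.-1).*2.
Proof. by rewrite /k -expnS; congr (_ ^ _); lia. Qed.

Let TE : s ^ q = s ^ 2 * k.
Proof. by rewrite /k -expnD; congr (_ ^ _); rewrite /q; lia. Qed.

Let card_down_in y : #|[pred x | down x y]| <= D.
Proof.
apply: leq_trans (upD y); apply/subset_leq_card/fintype.subsetP => x.
rewrite !unfold_in /= => /andP[xy /ltnW yx]; apply/andP; split=> //.
by rewrite esym.
Qed.

Let card_high : #|high| <= D * k.
Proof.
have := card_large_degree predT (s ^ 2) card_down_in.
rewrite -/high => H; have := leq_trans H (leq_mul (leqnn D) Ts).
by rewrite -/q TE mulnCA leq_pmul2l // expn_gt0 s0.
Qed.

Let card_dn0 i x : #|dn0 i x| <= s ^ 2.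
Proof.
have [hx|] := boolP (high x).
  by rewrite (_ : #|_| = 0) //; apply: eq_card0 => y; rewrite unfold_in /= hx.
rewrite /high /= -leqNgt; apply: leq_trans.
apply/subset_leq_card/fintype.subsetP => y.
by rewrite !unfold_in /= => /andP[_ ->].
Qed.

Let card_reach0 a x : #|reach up dn0 q a x| <= B * s ^ a.*2.
Proof.
have s20 (i : nat) : 0 < s ^ 2 by rewrite expn_gt0 s0.
have := card_reach q a x upD card_dn0 s20.
by rewrite prod_const_ord -expnM mul2n.
Qed.

(** Here [phi] is only the offset within a layer. The layers of [u] and [v] are not compared, which
    can only enlarge the set. *)
Let raised (phi : T -> 'I_k) : pred T := fun w =>
  [exists u, [exists v,
    [&& up w u, reach up dn0 q m.-1 w v, u != v & phi u == phi v]]].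
Let near_raised (phi : T -> 'I_k) : pred T := fun z =>
  [exists w, reach up dn0 q 0 z w && raised phi w].

(** The weight [wt u v] counts the pairs [x], [w] such that [x] ascends to [w] and [w] is raised
    once [u] and [v] agree. The total weight is at most [B * D * B * s^(2(m-1))] times [#|T|];
    dividing by [k] leaves [D * B^2 / s] times [#|T|]. The extra factors [s] and [D] on both sides
    fit the later count of [bad]. *)
Let exists_few_raised :
  exists phi : T -> 'I_k, s ^ 2 * (D * #|near_raised phi|) <= s * (D * (D * B ^ 2) * #|T|).
Proof.
pose f u v x w : nat :=
  reach up dn0 q 0 x w * (up w u * reach up dn0 q m.-1 w v).
pose wt u v := \sum_(x : T) \sum_(w : T) f u v x w.
have k0 : 0 < k by rewrite expn_gt0 s0.
have [phi phiP] := sparse_colouring wt k0; exists phi.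
have wtB : \sum_(u : T) \sum_(v : T) wt u v <= #|T| * (B * (D * (B * s ^ (m.-1).*2))).
  rewrite /wt exchange_big22 -sum_nat_const; apply: leq_sum => x _.
  have B0 : #|reach up dn0 q 0 x| <= B by have := card_reach0 0 x; rewrite muln1.
  apply: leq_trans (leq_mul B0 (leqnn _)).
  under eq_bigr => w _ do under eq_bigr => u _ do rewrite -big_distrr /=.
  under eq_bigr => w _ do rewrite -big_distrr /=.
  apply: sum_pred_le => w _.
  apply: leq_trans (leq_mul (upD w) (leqnn _)).
  under eq_bigr => u _ do rewrite -big_distrr /=.
  apply: sum_pred_le => u _.
  by rewrite -card_pred_sum.
have nrB : #|near_raised phi| <=
    \sum_(u : T) \sum_(v : T) wt u v * ((u != v) && (phi u == phi v)).
  rewrite card_pred_sum.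
  under [X in _ <= X]eq_bigr => u _ do under eq_bigr => v _ do
    (rewrite big_distrl /=; under eq_bigr => x _ do rewrite big_distrl /=).
  rewrite exchange_big22; apply: leq_sum => x _.
  apply: leq_trans (leq_exists_sum _) _; apply: leq_sum => w _.
  rewrite /f; case: (reach _ _ _ _ x w) => //=.
  apply: leq_trans (leq_exists_sum _) _; apply: leq_sum => u _.
  apply: leq_trans (leq_exists_sum _) _; apply: leq_sum => v _.
  by rewrite mul1n; case: (up w u) => //=; case: (reach _ _ _ _ w v) => //=; rewrite !mul1n.
have S0 : 0 < s ^ (m.-1).*2 by rewrite expn_gt0 s0.
move: (leq_trans (leq_mul (leqnn k) nrB) (leq_trans phiP wtB)).
rewrite kE; set S := s ^ _ in S0 *; set N := #|near_raised phi|; set n := #|T|.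
move=> H; have {}H : s * N <= n * (B * (D * B)).
  by rewrite -(leq_pmul2r S0); move: H; rewrite !mulnA -[s * S * N]mulnA [S * N]mulnC mulnA.
have := leq_mul (leqnn (s * D)) H.
rewrite (_ : s * D * (s * N) = s ^ 2 * (D * N)); last by ring.
by rewrite (_ : s * D * (n * _) = s * (D * (D * B ^ 2) * n)) //; ring.
Qed.

(** The colours come in three blocks, from below: [k] for each of the [L] layers, [2Bk + 1] for the
    raised vertices, and a private one for each vertex of [top]. *)
Lemma ranking_bound (l : nat) : l <= q ->
  vr_number e l <= (L + (B.*2.+1 + (D + D * (D * B ^ 2)))) * k.
Proof.
move=> lq; have [phi phiP] := exists_few_raised.
pose bad : pred T := [pred x | s < #|[pred y | down x y && near_raised phi y]|].
pose top : pred T := [pred x | high x || bad x].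
have k0 : 0 < k by rewrite expn_gt0 s0.
have card_bad : #|bad| <= D * (D * B ^ 2) * k.
  have := card_large_degree (near_raised phi) s card_down_in.
  rewrite -/bad => /(leq_mul (leqnn s)) H.
  have {}H : s ^ 2 * #|bad| <= D * (D * B ^ 2) * #|T|.
    rewrite -(leq_pmul2l s0); apply: leq_trans phiP.
    by move: H; move: #|bad| => b; nia.
  have := leq_trans H (leq_mul (leqnn _) Ts).
  by rewrite -/q TE mulnCA leq_pmul2l // expn_gt0 s0.
have card_top : #|top| <= (D + D * (D * B ^ 2)) * k.
  rewrite mulnDl; apply: leq_trans (leq_add card_high card_bad).
  rewrite !card_pred_sum -big_split; apply: leq_sum => x _ /=.
  by rewrite /top /=; case: (high x); case: (bad x).
(* Index 0 marks the descent that exhausts the budget. It must land near a raised vertex, which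
   leaves [s] choices instead of [s^2], hence [s * s^(2(m-1)) = k] over [m] descents. *)
pose dn1 i := [rel x y | [&& ~~ top x, down x y & (i == 0) ==> near_raised phi y]].
pose out := reach up dn1 q m.
have card_out x : #|out x| <= B * k.
  have H i y : #|dn1 i y| <= if i == 0 then s else s ^ 2.
    have [ty|] := boolP (top y).
      by rewrite (_ : #|_| = 0) //; apply: eq_card0 => z; rewrite unfold_in /= -/(top y) ty.
    rewrite negb_or => /andP[hy badN].
    case: eqP => [->|_].
      rewrite /bad /= -leqNgt in badN; apply: leq_trans badN.
      apply/subset_leq_card/fintype.subsetP => z.
      by rewrite !unfold_in /= => /and3P[_ -> ->].
    apply: leq_trans (card_dn0 0 y).
    apply/subset_leq_card/fintype.subsetP => z.
    by rewrite !unfold_in /= => /and3P[_ -> _]; rewrite andbT.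
  have H0 i : 0 < if i == 0 then s else s ^ 2 by case: ifP; rewrite ?expn_gt0 s0.
  apply: leq_trans (card_reach q m x upD H H0) _.
  rewrite leq_mul2l; apply/orP; right.
  case: (m) m0 kE => // m' _ ->.
  by rewrite big_ord_recl /= prod_const_ord -expnM mul2n.
have [psi [psiB psiP]] := outdegree_colouring card_out.
have colsep a b i j : a < k -> b < k -> i * k + a = j * k + b -> i = j /\ a = b.
  move=> ak bk E; have ij : i = j.
    by have := congr1 (divn^~ k) E; rewrite !divnMDl // !divn_small // !addn0.
  by split=> //; move: E; rewrite ij => /addnI.
pose R := raised phi.
pose col x := if top x then L * k + (B * k).*2.+1 + index x (enum top)
  else if R x then L * k + psi x else lam x * k + phi x.
have col_low x : lam x * k + phi x < L * k.
  apply: (@leq_trans ((lam x).+1 * k)); first by rewrite mulSn addnC ltn_add2r.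
  by rewrite leq_mul2r lamL orbT.
have col_mid x : L * k + psi x < L * k + (B * k).*2.+1 by rewrite ltn_add2l.
apply: (@leq_trans (L * k + (B * k).*2.+1 + #|top|)); last first.
  by move: card_top; move: #|top| => t; nia.
apply: (vr_number_le (col := col)) => [x|].
  rewrite /col; case: ifP => tx; first by rewrite ltn_add2l cardE index_mem mem_enum.
  case: ifP => _; first exact: ltn_addr.
  by rewrite -addnA; apply: ltn_addr.
apply: vertex_ranking_walk => x p xp pl xv cE.
have [/hasP[z zp zc]|/hasPn low] := boolP (has (fun z => col x < col z) p).
  by exists z.
have {}low z : z \in p -> col z <= col x by move/low; rewrite -leqNgt.
exfalso; have pq := leq_trans pl lq.
have [tx|tx] := boolP (top x).
  have [tv|tv] := boolP (top (last x p)).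
    move: cE; rewrite /col tx tv => /addnI /index_inj E.
    by move: xv; rewrite E ?eqxx // mem_enum.
  move: cE; rewrite /col tx (negPf tv); case: ifP => _ E.
    by have := col_mid (last x p); rewrite E ltnNge leq_addr.
  by have := col_low (last x p); rewrite E ltnNge -addnA leq_addr.
(* A vertex of [top] on the walk would have a larger colour than [x]. *)
have ptop : {in x :: p, forall z, ~~ top z}.
  move=> z; rewrite inE => /predU1P[->//|/low]; apply: contraTN => tz.
  rewrite -ltnNge /col tz (negPf tx); case: ifP => _.
    exact: leq_trans (col_mid x) (leq_addr _ _).
  by apply: leq_trans (col_low x) _; rewrite -addnA leq_addr.
have tv : ~~ top (last x p) by apply: ptop; rewrite mem_last.
have [Rx|Rx] := boolP (R x).
  have Rv : R (last x p).
    apply: contraT => Rv; have := col_low (last x p).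
    by move: cE; rewrite /col (negPf tx) (negPf tv) Rx (negPf Rv) => ->; rewrite ltnNge leq_addr.
  have psiE : psi (last x p) = psi x.
    by move: cE; rewrite /col (negPf tx) (negPf tv) Rx Rv => /addnI.
  have up_down : nsteps (lower lam) x p + nsteps (fun y z => lower lam z y) x p <= q.
    by apply: leq_trans pq; apply: nsteps_disjoint => y z; rewrite !lowerE; lia.
  have [xm|xm] := leqP (nsteps (lower lam) x p) m.
    have /(psiP _ _ xv) : out x (last x p) by apply: mem_reach_last.
    by rewrite psiE eqxx.
  have /psiP : out (last x p) x.
    have E : last (last x p) (rev (belast x p)) = x.
      by case: (p) => //= y p'; rewrite rev_cons last_rcons.
    rewrite -[X in out _ X]E; apply: mem_reach_last => //.
    - by rewrite rev_path (eq_path (e' := e)) // => ? ?; exact: esym.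
    - by rewrite size_rev size_belast.
    - by rewrite nsteps_rev; move: up_down xm; rewrite /q; lia.
    - move=> z; rewrite inE => /predU1P[->//|].
      by rewrite mem_rev => /mem_belast; exact: ptop.
    - by rewrite E.
  by rewrite eq_sym xv psiE eqxx => /(_ isT).
have Rv : ~~ R (last x p).
  apply: contraNN Rx => Rv; apply: contraT => Rx; have := col_low x.
  by move: cE; rewrite /col (negPf tx) (negPf tv) Rv (negPf Rx) => <-; rewrite ltnNge leq_addr.
(* A raised vertex would have a larger colour than [x]. Hence all colours on the walk have the form
   [lam z * k + phi z], and division by [k] recovers the layers. *)
have pR : {in x :: p, forall z, ~~ R z}.
  move=> z; rewrite inE => /predU1P[->//|zp]; apply: contraTN (low _ zp) => Rz.
  rewrite -ltnNge /col (negPf tx) (negPf Rx) Rz (negPf (ptop z _)) ?inE ?zp ?orbT //.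
  by apply: leq_trans (col_low x) (leq_addr _ _).
have [lv pv] : lam (last x p) = lam x /\ phi (last x p) = phi x.
  move: cE; rewrite /col (negPf tx) (negPf tv) (negPf Rx) (negPf Rv).
  by move=> /colsep[]// -> /val_inj ->.
have plam : {in p, forall z, lam z <= lam x}.
  move=> z zp; have := low _ zp.
  rewrite /col (negPf tx) (negPf Rx) (negPf (ptop z _)) ?(negPf (pR z _)) ?inE ?zp ?orbT //.
  by move=> /(leq_div2r k); rewrite !divnMDl // !divn_small // !addn0.
have dn0P i y z : ~~ top y -> down y z -> dn0 i y z.
  by rewrite negb_or => /andP[hy _] yz; apply/andP.
have pmq : size p <= m.*2.+1 <= q by rewrite pq leqnn.
have [w /pR/negP] := walk_has_raised esym m0 pmq dn0P xp ptop xv plam lv pv.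
by apply.
Qed.

End Ranking.

(** * Choice of parameters and real estimates *)

Lemma exists_root_ceil (n q : nat) : 0 < q -> 1 < n ->
  exists s, n <= s.+2 ^ q /\ s.+1 ^ q < n.
Proof.
move=> q0 n1.
have ex : exists s, n <= s ^ q.
  by exists n; rewrite -[X in X <= _]expn1 leq_pexp2l // ltnW.
case: (ex_minnP ex) => [[|[|s]]] ns smin.
- by move: ns; rewrite exp0n // leqNgt (ltnW n1).
- by move: ns; rewrite exp1n leqNgt n1.
exists s; split=> //; rewrite ltnNge; apply/negP => /smin.
by rewrite ltnn.
Qed.

Local Open Scope ring_scope.

(** Since [s + 2 <= 2(s + 1)], rounding the root up costs only a factor [2^(2m-1)]. *)
Lemma root_ceil_powR (R : realType) (n s m : nat) : (s.+1 ^ (m.*2).+1 < n)%N ->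
  (s.+2 ^ (m.*2).-1)%:R <=
    (2 ^ (m.*2).-1)%:R * (n%:R `^ ((m.*2).-1%:R / (m.*2).+1%:R)) :> R.
Proof.
move=> sn; set q := (m.*2).+1 in sn *; set j := (m.*2).-1.
apply: (@le_trans _ _ ((2 ^ j)%:R * (s.+1 ^ j)%:R)).
  by rewrite -natrM ler_nat -expnMn; case: j => // j; rewrite leq_exp2r //; lia.
rewrite ler_wpM2l ?ler0n // natrX -powR_mulrn ?ler0n //.
have q0 : (q%:R : R) != 0 by rewrite pnatr_eq0.
have -> : s.+1%:R `^ j%:R = (s.+1%:R `^ q%:R) `^ (j%:R / q%:R) :> R.
  by rewrite -powRrM mulrCA divff // mulr1.
rewrite ge0_ler_powR ?nnegrE ?divr_ge0 ?powR_ge0 ?ler0n //.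
by rewrite powR_mulrn ?ler0n // -natrX ler_nat ltnW.
Qed.

(** As [n] is at least 2, the truncated logarithm is at least 1, so adding one at most doubles
    it. *)
Lemma trunc_log2_ln (R : realType) (n : nat) : (1 < n)%N ->
  ((trunc_log 2 n).+1%:R : R) <= 2 / ln 2 * ln n%:R.
Proof.
move=> n1; have ln2 : 0 < ln 2 :> R by rewrite ln_gt0 // ltr1n.
rewrite mulrAC ler_pdivlMr //.
apply: (@le_trans _ _ (2 * ((trunc_log 2 n)%:R * ln 2))).
  rewrite mulrA ler_pM2r // -natrM ler_nat.
  have : (0 < trunc_log 2 n)%N by rewrite trunc_log_gt0.
  lia.
rewrite ler_wpM2l // mulr_natl -lnXn // ler_ln ?posrE ?exprn_gt0 ?ltr0n ?(ltnW n1) //.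
by rewrite -natrX ler_nat trunc_logP // ltnW.
Qed.

Lemma exponent_natr (R : realType) (m : nat) : (0 < m)%N ->
  1 - 1 / (m%:R + 1 / 2) = (m.*2).-1%:R / (m.*2).+1%:R :> R.
Proof.
case: m => // m _; rewrite doubleS /= -!natr1 -muln2 natrM.
have m0 : 0 <= m%:R :> R by rewrite ler0n.
by field; rewrite ?gt_eqF //; lra.
Qed.

Theorem theorem2 (R : realType) (d l : nat) (hd : (0 < d)%N) (hl : (1 < l)%N) :
  exists c : R, forall n : nat, (d <= n)%N -> (1 < n)%N ->
    ((c * (n%:R `^ (1 - 1 / ((l %/ 2)%:R + 1 / 2))) * ln n%:R)%R =
     (if odd l then c * (n%:R `^ (1 - 2 / l%:R)) * ln n%:R
      else c * (n%:R `^ (1 - 2 / (l.+1)%:R)) * ln n%:R)%R) /\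
    forall (T : finType) (e : rel T),
      simple_graph e -> #|T| = n -> degenerate e d ->
      ((vr_number e l)%:R <= c * (n%:R `^ (1 - 1 / ((l %/ 2)%:R + 1 / 2))) * ln n%:R)%R.
Proof.
rewrite divn2; set m := l./2.
have m0 : (0 < m)%N by rewrite half_gt0.
have lE : l = (odd l + m.*2)%N by rewrite odd_double_half.
pose D := (4 * d)%N; pose B := (D.+2 ^ (m.*2).+1)%N.
pose C := (1 + (B.*2.+1 + (D + D * (D * B ^ 2))))%N.
(* The summand 1 in [C] absorbs the number [L] of layers, as [L + b <= (1 + b) * L] for [L >= 1].
   The other factors come from rounding the root and the logarithm. *)
exists (C%:R * (2 ^ (m.*2).-1)%:R * (2 / ln 2)) => n dn n1; split.
  have -> : 1 - 1 / (m%:R + 1 / 2) = 1 - 2 / (m.*2).+1%:R :> R.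
    have m0' : 0 <= m%:R :> R by rewrite ler0n.
    have -> : (m.*2.+1)%:R = 2 * m%:R + 1 :> R by rewrite -addn1 natrD -mul2n natrM.
    by field; rewrite ?gt_eqF //; lra.
  by case: (odd l) lE => /= E; rewrite [in RHS]E.
move=> T e [esym eirr] Tn dg.
have [s [ns sn]] := exists_root_ceil (ltn0Sn (m.*2)) n1.
have T2 : (#|[set: T]%SET| < 2 ^ (trunc_log 2 n).+1)%N.
  by rewrite finset.cardsT Tn trunc_log_ltn.
have [lam [lamL lamP]] := degenerate_layering esym eirr dg T2.
have lamL' x : (lam x < (trunc_log 2 n).+1)%N by apply: lamL; rewrite finset.in_setT.
have upD x : (#|ascend e lam x| <= D)%N.
  apply: leq_trans (lamP x _); last by rewrite finset.in_setT.
  apply/subset_leq_card/fintype.subsetP => y.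
  by rewrite unfold_in finset.in_set finset.in_setT.
(* An even [l] is treated like [l + 1]. *)
have lq : (l <= (m.*2).+1)%N by rewrite lE; case: (odd l); lia.
have Ts : (#|T| <= s.+2 ^ (m.*2).+1)%N by rewrite Tn.
have H := ranking_bound esym lamL' upD m0 (ltn0Sn _) Ts lq.
rewrite exponent_natr //; set P := _ `^ _.
have {}H : (vr_number e l <= C * (trunc_log 2 n).+1 * s.+2 ^ (m.*2).-1)%N.
  apply: leq_trans H _; rewrite leq_mul2r; apply/orP; right.
  rewrite -/B /C; nia.
apply: (@le_trans _ _ (C * (trunc_log 2 n).+1 * s.+2 ^ (m.*2).-1)%:R); first by rewrite ler_nat.
rewrite !natrM.
apply: (@le_trans _ _ (C%:R * (2 / ln 2 * ln n%:R) * ((2 ^ (m.*2).-1)%:R * P))).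
  apply: ler_pM; rewrite ?mulr_ge0 ?ler0n //; last exact: root_ceil_powR.
  by rewrite ler_wpM2l ?ler0n // trunc_log2_ln.
by rewrite le_eqVlt; apply/orP; left; apply/eqP; ring.
Qed.
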